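(* Let $n\ge 2$. For each $k\ge n+2$ there is a full $k$-coloring $\Gamma$ of $\mathbb{S}^n$ such that every great $(n-1)$-sphere $S\subset\mathbb{S}^n$ is colored with $n+1$ or fewer colors, i.e. $|\Gamma(S)|\le n+1$.
   Context: The standard $n$-sphere is $\mathbb{S}^n$, the unit sphere in $\mathbb{R}^{n+1}$. A full $k$-coloring of $\mathbb{S}^n$ is a surjective map $\Gamma:\mathbb{S}^n\to\{1,\dots,k\}$; no regularity is assumed. A great $(n-1)$-sphere is the intersection of $\mathbb{S}^n$ with a hyperplane of $\mathbb{R}^{n+1}$ passing through the origin (an $n$-dimensional linear subspace). *)

(* Defs.v *)
From HB Require Import structures.
From mathcomp Require Import all_boot all_order all_algebra.
From mathcomp Require Import all_classical all_reals.

Set Implicit Arguments.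
Unset Strict Implicit.
Unset Printing Implicit Defensive.

Import Order.TTheory GRing.Theory Num.Theory.

Local Open Scope classical_set_scope.
Local Open Scope ring_scope.

(* The norm is written out because the library's norm on row vectors is the
   sup norm. *)
Definition unit_sphere (R : realType) (n : nat) : set 'rV[R]_n.+1 :=
  [set x | Num.sqrt (\sum_(i < n.+1) x ord0 i ^+ 2) = 1].

Arguments unit_sphere : clear implicits.

(* The colors 1, ..., k are represented by 0, ..., k-1. *)
Definition full_coloring (R : realType) (n k : nat)
    (Gamma : unit_sphere R n -> 'I_k) : Prop :=
  set_surj [set: unit_sphere R n] [set: 'I_k] Gamma.

Definition great_sphere (R : realType) (n : nat) (S : set (unit_sphere R n)) :
    Prop :=
  exists2 H : {vspace 'rV[R]_n.+1},
    \dim H = n & S = [set x | \val x \in H].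

(* Main.v *)
Require Import Defs.
From HB Require Import structures.
From mathcomp Require Import all_boot all_order all_algebra.
From mathcomp Require Import all_classical all_reals.

(** A hyperplane meets the moment curve t |-> (1, t, ..., t ^ n) in at most n
    points, because restricting a nonzero linear form to the curve gives a
    nonzero polynomial of degree at most n ([moment_in_vspace]).  So take k - 1
    points of the curve, push them radially to the sphere, give each of them a
    color of its own, and give the one remaining color to the rest of the
    sphere.  A great (n-1)-sphere contains at most n of the special points, and
    hence sees at most n + 1 colors.  All the special points have a positive
    first coordinate, so their complement is not empty and every color is
    used. *)

Set Implicit Arguments.
Unset Strict Implicit.
Unset Printing Implicit Defensive.

Import Order.TTheory GRing.Theory Num.Theory.

Local Open Scope classical_set_scope.
Local Open Scope ring_scope.

Definition moment (F : fieldType) (n : nat) (t : F) : 'rV[F]_n.+1 :=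
  \row_(j < n.+1) t ^+ j.

(** The coordinates of [\1 - projv H] are linear forms that vanish on [H]; one
    of them is nonzero because [H] is proper.  Its coefficients are those of a
    nonzero polynomial that has every such parameter [t] as a root. *)
Lemma moment_in_vspace (F : fieldType) (n : nat) (H : {vspace 'rV[F]_n.+1})
    (ts : seq F) :
  (\dim H <= n)%N -> uniq ts -> all (fun t => moment n t \in H) ts ->
  (size ts <= n)%N.
Proof.
move=> dimH uts tsH.
pose f x := x - projv H x.
pose q j : {poly F} := \poly_(i < n.+1) f (delta_mx ord0 (inord i)) ord0 j.
have fE (x : 'rV[F]_n.+1) j :
    f x ord0 j = \sum_(i < n.+1) x ord0 i * f (delta_mx ord0 i) ord0 j.
  rewrite {1}[x]row_sum_delta /f linear_sum -sumrB summxE.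
  by apply: eq_bigr => i _; rewrite linearZ -scalerBr mxE.
have qE j t : (q j).[t] = f (moment n t) ord0 j.
  rewrite fE horner_poly; apply: eq_bigr => i _.
  by rewrite inord_val [moment n t _ _]mxE mulrC.
have [j qj0] : exists j, q j != 0.
  apply: contrapT => nex.
  have q0 j : q j = 0.
    by apply/eqP/negPn/negP => qj; apply: nex; exists j.
  suff eH : H = fullv by move: dimH; rewrite eH dimvf /dim /= mul1n ltnn.
  apply/vspaceP => x; rewrite memvf.
  suff /eqP : f x = 0 by rewrite subr_eq0 => /eqP ->; exact: memv_proj.
  apply/rowP => j; rewrite fE mxE big1 // => i _.
  move/polyP/(_ i): (q0 j).
  by rewrite coef_poly ltn_ord inord_val coef0 => ->; rewrite mulr0.
have roots_q : all (root (q j)) ts.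
  apply/allP => t /(allP tsH) tH.
  by rewrite /root qE /f projv_id // subrr mxE.
by rewrite -ltnS (leq_trans (max_poly_roots qj0 roots_q uts)) ?size_poly.
Qed.

Section SphericalMomentCurve.
Variables (R : realType) (n : nat).

Let sqnorm (x : 'rV[R]_n.+1) := \sum_(i < n.+1) x ord0 i ^+ 2.

Definition moment_sphere (t : R) : 'rV[R]_n.+1 :=
  (Num.sqrt (sqnorm (moment n t)))^-1 *: moment n t.

Lemma moment_scale_gt0 t : 0 < (Num.sqrt (sqnorm (moment n t)))^-1.
Proof.
rewrite invr_gt0 sqrtr_gt0 /sqnorm big_ord_recl mxE expr0 expr1n.
by rewrite ltr_pwDl ?ltr01 // sumr_ge0 // => i _; rewrite sqr_ge0.
Qed.

Lemma moment_sphere0_gt0 t : 0 < moment_sphere t ord0 ord0.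
Proof. by rewrite !mxE expr0 mulr1 moment_scale_gt0. Qed.

Lemma moment_sphereP t : unit_sphere R n (moment_sphere t).
Proof.
have c0 := moment_scale_gt0 t; rewrite /unit_sphere /=.
under eq_bigr do rewrite mxE exprMn.
rewrite -mulr_sumr sqrtrM ?sqr_ge0 // sqrtr_sqr gtr0_norm //.
by rewrite mulVf // -invr_eq0 gt_eqF.
Qed.

Lemma moment_sphere_inj : (0 < n)%N -> injective moment_sphere.
Proof.
move=> n0 s t /rowP est.
have := est (inord 1); have := est ord0.
rewrite !mxE inordK // !expr0 !mulr1 !expr1 => ->.
by apply: mulfI; rewrite gt_eqF ?moment_scale_gt0.
Qed.

Lemma moment_sphere_mem t (H : {vspace 'rV[R]_n.+1}) :
  (moment_sphere t \in H) = (moment n t \in H).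
Proof. by rewrite rpredZeq gt_eqF ?moment_scale_gt0. Qed.

End SphericalMomentCurve.

Section Coloring.
Variables (R : realType) (n m : nat).

Definition node (i : 'I_m) : 'rV[R]_n.+1 := moment_sphere n i%:R.

Definition node_coloring (x : unit_sphere R n) : 'I_m.+1 :=
  if [pick i | node i == val x] is Some i then lift ord_max i else ord_max.

Lemma node_inj : (0 < n)%N -> injective node.
Proof.
move=> n0 i j /(moment_sphere_inj n0)/eqP.
by rewrite eqr_nat => /eqP/val_inj.
Qed.

Lemma card_node_in_vspace (H : {vspace 'rV[R]_n.+1}) :
  (\dim H <= n)%N -> (#|[set i | node i \in H]%SET| <= n)%N.
Proof.
move=> dimH.
rewrite cardE -(size_map (fun i : 'I_m => i%:R : R)).
apply: moment_in_vspace dimH _ _.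
  rewrite map_inj_uniq ?enum_uniq // => i j /eqP.
  by rewrite eqr_nat => /eqP/val_inj.
apply/allP => _ /mapP[i + ->].
by rewrite mem_enum inE moment_sphere_mem.
Qed.

(** Each node shows that its own color is used.  For the last color the antipode
    of a point of the curve serves: its first coordinate is negative, so it is
    not a node. *)
Lemma node_coloring_full : (0 < n)%N -> full_coloring node_coloring.
Proof.
move=> n0 c _.
have [i ->|->] := unliftP ord_max c.
  exists (SigSub (mem_set (moment_sphereP n i%:R))) => //.
  rewrite /node_coloring /=; case: pickP => [j /eqP/(node_inj n0) -> //|].
  by move/(_ i); rewrite eqxx.
have Np : unit_sphere R n (- moment_sphere n 0).
  rewrite /unit_sphere /=; under eq_bigr do rewrite mxE sqrrN.
  exact: (moment_sphereP n 0).
exists (SigSub (mem_set Np)) => //.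
rewrite /node_coloring /=; case: pickP => // i /eqP/rowP/(_ ord0).
rewrite [RHS]mxE => e.
have := moment_sphere0_gt0 n (i%:R : R); rewrite -[moment_sphere _ _]/(node i).
by rewrite e oppr_gt0 ltNge ltW ?moment_sphere0_gt0.
Qed.

Lemma node_coloring_great_sphere (S : set (unit_sphere R n)) :
  great_sphere S -> (node_coloring @` S #<= `I_(n + 1))%card.
Proof.
move=> [H dimH ->].
(* The colors that can occur: the common one and those of the nodes in H. *)
pose s := ord_max :: [seq lift ord_max i | i in [set i | node i \in H]%SET].
have size_s : (size s <= n + 1)%N.
  by rewrite /= size_image addn1 ltnS card_node_in_vspace ?dimH.
apply: card_le_trans (card_image_le (nth ord_max s) _).
apply: subset_card_le => _ [x xH <-].
have xs : node_coloring x \in s.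
  rewrite /node_coloring; case: pickP => [i /eqP xi|_]; rewrite inE ?eqxx //.
  by apply/orP; right; apply: fintype.image_f; rewrite inE xi.
exists (index (node_coloring x) s); last exact: nth_index.
by apply: leq_trans size_s; rewrite index_mem.
Qed.

End Coloring.

Theorem proposition5p2 (R : realType) (n : nat) (hn : (2 <= n)%N)
    (k : nat) (hk : (n + 2 <= k)%N) :
  exists Gamma : unit_sphere R n -> 'I_k,
    full_coloring Gamma /\
    forall S : set (unit_sphere R n), great_sphere S ->
      (Gamma @` S #<= `I_(n + 1))%card.
Proof.
case: k hk => [|m hk]; first by rewrite addn2.
exists (@node_coloring R n m); split; last exact: node_coloring_great_sphere.
exact: node_coloring_full (ltnW hn).
Qed.
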